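(* Let $n\ge1$, let $a_0,\dots,a_n$ and $x$ be real numbers, let $P(x)=\sum_{i=0}^n a_ix^i$ and assume $P(x)\ne0$. Let $\widehat P(x)=\widehat r_{2n}$ be the value computed by Horner's rule under SR-nearness with $u=\beta^{1-p}$: $\widehat r_0=a_n$ and, for $1\le k\le n$, $$\widehat r_{2k-1}=\widehat r_{2k-2}\,x\,(1+\delta_{2k-1}),\qquad \widehat r_{2k}=(\widehat r_{2k-1}+a_{n-k})(1+\delta_{2k}),$$ where $\delta_{2k-1},\delta_{2k}$ are the SR-nearness relative errors of the product and of the addition. Then for all $0<\lambda<1$, with probability at least $1-\lambda$, $$\frac{|\widehat P(x)-P(x)|}{|P(x)|}\le\mathcal K_1\sqrt{u\,\gamma_{4n}(u)}\,\sqrt{\ln(2/\lambda)},$$ where $\mathcal K_1=\dfrac{\sum_{i=0}^n|a_ix^i|}{|P(x)|}$ and $\gamma_{4n}(u)=(1+u)^{4n}-1$.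
   Context: Floating-point numbers: fix a base $\beta\ge2$ and precision $p\ge1$ (integers); $\mathcal F$ is the set of normal floating-point numbers $\pm m\beta^{e-p}$ with $m,e$ integers and $\beta^{p-1}\le m<\beta^p$ (underflow and overflow are ignored, so $e$ ranges over all integers). Put $u=\beta^{1-p}$. For real $x\ne0$, $\lceil x\rceil=\min\{y\in\mathcal F:y\ge x\}$, $\lfloor x\rfloor=\max\{y\in\mathcal F:y\le x\}$, and, for $x\notin\mathcal F$, $\theta(x)=(x-\lfloor x\rfloor)/(\lceil x\rceil-\lfloor x\rfloor)$. SR-nearness (stochastic rounding): for $x\notin\mathcal F\cup\{0\}$, $\mathrm{fl}(x)=\lceil x\rceil$ with probability $\theta(x)$ and $\mathrm{fl}(x)=\lfloor x\rfloor$ with probability $1-\theta(x)$; if $x\in\mathcal F\cup\{0\}$, $\mathrm{fl}(x)=x$. In a sequence of elementary operations $c_k\leftarrow a_k\,\mathrm{op}_k\,b_k$, $\mathrm{op}_k\in\{+,-,*,/\}$, whose operands are data or previously computed values, each rounding is made with these probabilities conditionally on all previous roundings. The relative error $\delta_k$ of the $k$th operation is defined by $\widehat c_k=\mathrm{fl}(\widehat a_k\,\mathrm{op}_k\,\widehat b_k)=(\widehat a_k\,\mathrm{op}_k\,\widehat b_k)(1+\delta_k)$, with $\delta_k=0$ when the exact result is $0$. It is known that $|\delta_k|\le u$ and $\mathbb{E}[\delta_k\mid\delta_1,\dots,\delta_{k-1}]=\mathbb{E}(\delta_k)=0$ for all $k$ (mean independence). Here the operations are performed in the order of the indices $1,2,\dots,2n$,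 and input data are used exactly. *)

(* Defs.v *)
From HB Require Import structures.
From mathcomp Require Export all_boot all_order all_algebra.
From mathcomp Require Export all_classical all_reals all_analysis.
Export Order.TTheory GRing.Theory Num.Theory.
Export numFieldNormedType.Exports.

Set Implicit Arguments.
Unset Strict Implicit.
Unset Printing Implicit Defensive.

Global Open Scope classical_set_scope.
Global Open Scope ring_scope.

(* Normal floating-point numbers: the exponent is unbounded and 0 is not
   included. *)
Definition fp (R : realType) (beta p : nat) : set R :=
  [set y | exists (s : bool) (m : nat) (e : int),
     (beta ^ p.-1 <= m < beta ^ p)%N /\
     y = (-1) ^+ s * m%:R * (beta%:R : R) ^ (e - p%:Z)].

Definition fp_unit (R : realType) (beta p : nat) : R :=
  (beta%:R : R) ^ (1 - p%:Z).

(* Minimum and maximum of a set of reals (0 by convention if there is none;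
   this does not occur for [fp_ceil] and [fp_floor] at a nonzero real). *)
Definition set_min (R : realType) (A : set R) : R := xget 0 (A `&` lbound A).
Definition set_max (R : realType) (A : set R) : R := xget 0 (A `&` ubound A).

Definition fp_ceil (R : realType) (beta p : nat) (x : R) : R :=
  set_min [set y | fp beta p y /\ x <= y].

Definition fp_floor (R : realType) (beta p : nat) (x : R) : R :=
  set_max [set y | fp beta p y /\ y <= x].

Definition fp_theta (R : realType) (beta p : nat) (x : R) : R :=
  (x - fp_floor beta p x) / (fp_ceil beta p x - fp_floor beta p x).

(* [sr_prob beta p x y] is the probability that fl(x) = y under SR-nearness. *)
Definition sr_prob (R : realType) (beta p : nat) (x y : R) : R :=
  if `[< fp beta p x \/ x = 0 >] then (y == x)%:R
  else if y == fp_ceil beta p x then fp_theta beta p x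
  else if y == fp_floor beta p x then 1 - fp_theta beta p x
  else 0.

Definition cond_prob d (T : measurableType d) (R : realType)
    (P : probability T R) (A B : set T) : R :=
  fine (P (A `&` B)) / fine (P B).

(* [op k v] is the exact result of the k-th elementary operation when the
   value computed by the j-th one is [v j] for every j < k, [v 0] being the
   initial value. Each rounding follows the SR-nearness law conditionally on
   every possible history of the computation. *)
Definition sr_nearness d (T : measurableType d) (R : realType)
    (P : probability T R) (beta p N : nat) (op : nat -> (nat -> R) -> R)
    (c : nat -> {RV P >-> R}) : Prop :=
  forall (k : nat) (v : nat -> R), (1 <= k <= N)%N ->
  let history := [set t | forall j, (j < k)%N -> c j t = v j] in
  (0 < P history)%E ->
  forall y : R,
    cond_prob P [set t | c k t = y] history = sr_prob beta p (op k v) y.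

(* Operation 2k-1 is the product by x, operation 2k the addition of
   a_(n-k). *)
Definition horner_op (R : realType) (n : nat) (a : nat -> R) (x : R)
    (k : nat) (v : nat -> R) : R :=
  if odd k then v k.-1 * x else v k.-1 + a (n - k./2)%N.

Definition gamma_err (R : realType) (m : nat) (u : R) : R := (1 + u) ^+ m - 1.

(* Main.v *)
(** Put Z_k = r_k x^(n - ceil(k/2)) + sum_(i < n - floor(k/2)) a_i x^i, so that
    Z_0 = P(x) and Z_2n is the computed value. Replacing r_k in Z_k by the exact
    result of the k-th operation gives back Z_(k-1); as SR-nearness is unbiased,
    Z is a martingale, with increments bounded by u (1+u)^(k-1) sum |a_i x^i|.
    The bound is then the Azuma-Hoeffding inequality. The computation has only
    finitely many histories up to a null event, so the Chernoff bound can be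
    proved by backward induction on the length of a history, using Hoeffding's
    lemma for a finitely supported law at each step and no conditional
    expectation. *)

Require Import Defs.
From mathcomp Require Import measurable_realfun ring lra zify.

Set Implicit Arguments.
Unset Strict Implicit.
Unset Printing Implicit Defensive.

(** * Hoeffding's lemma for finitely supported laws *)

(** By parity [y] may be taken nonnegative; there 2 cosh z exp(- z^2 / 2), the [g] of the proof, is
    nonincreasing with value 2 at 0. *)
Lemma cosh_le_expR (R : realType) (y : R) :
  expR y + expR (- y) <= 2 * expR (y ^+ 2 / 2).
Proof.
wlog y0 : y / 0 <= y.
  move=> th; have [/th//|/ltW y0] := leP 0 y.
  by have := th (- y); rewrite oppr_ge0 opprK sqrrN addrC => /(_ y0).
(* This is 2 (z cosh z - sinh z), null at 0 with derivative 2 z sinh z; it gives the sign of the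
   derivative of [g]. *)
pose f (z : R) := (z - 1) * expR z + (z + 1) * expR (- z).
have df (z : R) : is_derive z 1 f (z * (expR z - expR (- z))).
  by rewrite /f; apply: is_derive_eq; rewrite /GRing.scale /=; ring.
have f0 z : 0 <= z -> 0 <= f z.
  move=> z0; have f0 : f 0 = 0 by rewrite /f oppr0; ring.
  rewrite -f0; apply: (@ger0_derive1_ndecry _ f 0) => // [w|].
  - rewrite in_itv /= andbT => w0.
    rewrite derive1E derive_val mulr_ge0 ?(ltW w0)// subr_ge0 ler_expR; lra.
  - apply: continuous_subspaceT => w; apply/differentiable_continuous.
    by apply/derivable1_diffP; apply: ex_derive.
pose g (z : R) := expR (z - z ^+ 2 / 2) + expR (- z - z ^+ 2 / 2).
have dg (z : R) : is_derive z 1 g (- (expR (- (z ^+ 2 / 2)) * f z)).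
  rewrite /g; apply: is_derive_eq; rewrite /GRing.scale /= /f !expRD /=.
  by field.
have : g y <= g 0.
  apply: (@ler0_derive1_nincry _ g 0) => // [w|].
  - rewrite in_itv /= andbT => w0.
    by rewrite derive1E derive_val oppr_le0 mulr_ge0 ?expR_ge0 ?f0// ltW.
  - apply: continuous_subspaceT => w; apply/differentiable_continuous.
    by apply/derivable1_diffP; apply: ex_derive.
rewrite /g expr0n /= mul0r oppr0 addr0 expR0 !expRD -mulrDl.
rewrite (expRN (y ^+ 2 / 2)).
by rewrite ler_pdivrMr ?expR_gt0.
Qed.

(** Convexity of exp: [d] is the barycentre of [c] and [- c] with these weights. *)
Lemma expR_le_chord (R : realType) (c d : R) : 0 < c -> `|d| <= c ->
  expR d <= (c + d) / (2 * c) * expR c + (c - d) / (2 * c) * expR (- c).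
Proof.
move=> c0; rewrite ler_norml => /andP[cd dc].
(* Divided by [expR d], the claim follows from the tangent at 0. *)
have := expR_ge1Dx (c - d); have := expR_ge1Dx (- c - d) => h1 h2.
rewrite -(ler_pM2r (expR_gt0 (- d))) -expRD subrr expR0 mulrDl -!mulrA -!expRD.
have A : 0 <= (c + d) / (2 * c) by rewrite divr_ge0 ?mulr_ge0; lra.
have B : 0 <= (c - d) / (2 * c) by rewrite divr_ge0 ?mulr_ge0; lra.
rewrite !mulrA; apply: le_trans (lerD (ler_wpM2l A h2) (ler_wpM2l B h1)).
rewrite le_eqVlt; apply/orP; left; apply/eqP; field.
by rewrite gt_eqF.
Qed.

(** The chord bound is affine in [D i]; the zero mean kills its linear part and leaves cosh c. The
    exponent is the classical (2 c)^2 / 8. *)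
Lemma hoeffding_lemma (R : realType) (I : eqType) (s : seq I) (q D : I -> R)
    (c : R) :
  \sum_(i <- s) q i = 1 -> {in s, forall i, 0 <= q i} ->
  \sum_(i <- s) q i * D i = 0 -> {in s, forall i, `|D i| <= c} ->
  \sum_(i <- s) q i * expR (D i) <= expR (c ^+ 2 / 2).
Proof.
move=> q1 q0 qD Dc.
(* The chord divides by [2 * c]; for [c <= 0] every [D i] on the support is 0. *)
have [c0|c0] := leP c 0.
  have D0 i : i \in s -> D i = 0.
    by move=> /Dc Di; apply/normr0_eq0/le_anti; rewrite normr_ge0 (le_trans Di).
  rewrite (@le_trans _ _ 1)//; last first.
    by rewrite -expR0 ler_expR divr_ge0 ?sqr_ge0.
  rewrite -q1 big_seq [leRHS]big_seq; apply: ler_sum => i si.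
  by rewrite D0// expR0 mulr1.
rewrite (@le_trans _ _ (\sum_(i <- s) q i * ((c + D i) / (2 * c) * expR c
    + (c - D i) / (2 * c) * expR (- c))))//.
  rewrite big_seq [leRHS]big_seq; apply: ler_sum => i si.
  by rewrite ler_wpM2l ?q0// expR_le_chord// Dc.
under eq_bigr => i _.
  rewrite (_ : _ * _ = q i * ((expR c + expR (- c)) / 2) +
    q i * D i * ((expR c - expR (- c)) / (2 * c))); last first.
    by field; rewrite gt_eqF.
  over.
rewrite big_split/= -!mulr_suml q1 qD mul1r mul0r addr0.
by rewrite ler_pdivrMr// mulrC cosh_le_expR.
Qed.

(** * Neighbouring floating-point numbers and the SR-nearness law *)

Lemma exprz_floor_log (R : realType) (b y : R) : 1 < b -> 0 < y ->
  exists e : int, b ^ e <= y < b ^ (e + 1).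
Proof.
move=> b1 y0; have b0 : 0 < b by apply: lt_trans b1.
have lb : 0 < ln b by rewrite ln_gt0.
exists (Num.floor (ln y / ln b)).
have /andP[h1 h2] := floor_itv (ln y / ln b).
have E (z : int) : b ^ z = expR (z%:~R * ln b).
  by rewrite -powR_intmul ?ltW// /powR gt_eqF.
rewrite !E -[y in (_ <= y < _)]lnK// ler_expR ltr_expR.
by rewrite -ler_pdivlMr// h1 -ltr_pdivrMr.
Qed.

Lemma fpN (R : realType) (beta p : nat) (y : R) :
  fp beta p (- y) = fp beta p y.
Proof.
have H z : fp beta p z -> fp beta p (- z).
  move=> [s [m [e [hm ->]]]]; exists (~~ s), m, e; split=> //.
  by case: s; rewrite ?expr0 ?expr1; ring.
by apply/propext; split=> /H; rewrite ?opprK.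
Qed.

(** Between consecutive powers of the base the floats are equally spaced, and the spacing is
    [fp_unit] times the lower power, hence at most [fp_unit] times the modulus of [y]. *)
Lemma fp_neighbours (R : realType) (beta p : nat) (y : R) :
  (2 <= beta)%N -> (1 <= p)%N -> y != 0 -> ~ fp beta p y ->
  exists lo hi, [/\ fp beta p lo, fp beta p hi, lo < y < hi,
    hi - lo <= fp_unit R beta p * `|y| &
    forall z, fp beta p z -> (z <= lo) || (hi <= z)].
Proof.
move=> hb hp; wlog y0 : y / 0 < y.
  move=> th y0 fy; have [yn|yn|] := ltgtP y 0; last by move/eqP: y0.
    have [||//|lo [hi [f1 f2 /andP[l1 l2] l3 l4]]] := th (- y).
    - by rewrite oppr_gt0.
    - by rewrite oppr_eq0.
    - by rewrite fpN.
    exists (- hi), (- lo); split; rewrite ?fpN//.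
    - by apply/andP; split; lra.
    - by move: l3; rewrite normrN opprK addrC.
    - by move=> z; rewrite -fpN => /l4; rewrite orbC (lerNr hi) (lerNl _ lo).
  exact: th.
move=> _ fy; set b : R := beta%:R.
have b1 : 1 < b by rewrite ltr1n.
have b0 : 0 < b by apply: lt_trans b1.
have bn0 : b != 0 by rewrite gt_eqF.
have [e /andP[e1 e2]] := exprz_floor_log b1 y0.
(* [q] is the spacing of the floats in [[b ^ e, b ^ (e + 1)]]. *)
pose q := b ^ (e + 1 - p%:Z).
have q0 : 0 < q by rewrite exprz_gt0.
have qp : q * b ^+ p = b ^ (e + 1).
  by rewrite exprnP -expfzDr// subrK.
have qp1 : q * b ^+ p.-1 = b ^ e.
  by rewrite exprnP -expfzDr//; congr (_ ^ _); lia.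
pose m := Num.truncn (y / q).
have /andP[m1 m2] : m%:R <= y / q < m.+1%:R.
  by apply: truncn_itv; rewrite divr_ge0 ?ltW.
have {m1} m1 : m%:R * q <= y by rewrite -ler_pdivlMr.
have {m2} m2 : y < m.+1%:R * q by rewrite -ltr_pdivrMr.
have mlo : (beta ^ p.-1 <= m)%N.
  rewrite -ltnS -(ltr_nat R) natrX -(ltr_pM2r q0) mulrC qp1.
  exact: le_lt_trans m2.
have mhi : (m < beta ^ p)%N.
  rewrite -(ltr_nat R) natrX -(ltr_pM2r q0) [ltRHS]mulrC qp.
  exact: le_lt_trans e2.
have flo : fp beta p (m%:R * q).
  by exists false, m, (e + 1); rewrite mlo mhi expr0 mul1r.
have fhi : fp beta p (m.+1%:R * q).
  (* If [m.+1] reaches [beta ^ p], it is no longer a significand: the upper neighbour is then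
     [b ^ (e + 1)], the first float of the next range. *)
  have [mp|mp] := ltnP m.+1 (beta ^ p).
    by exists false, m.+1, (e + 1); rewrite mp (leq_trans mlo) ?expr0 ?mul1r.
  have {}mp : m.+1 = (beta ^ p)%N by apply/eqP; rewrite eqn_leq mhi mp.
  exists false, (beta ^ p.-1)%N, (e + 2); split.
    by rewrite leqnn ltn_exp2l //= ltn_predL.
  rewrite mp !natrX expr0 mul1r -/b mulrC qp exprnP -expfzDr//.
  by congr (_ ^ _); lia.
exists (m%:R * q), (m.+1%:R * q); split => //.
- rewrite m2 andbT lt_neqAle m1 andbT; apply/eqP => my.
  by apply: fy; rewrite -my.
- rewrite -natr1 mulrDl mul1r addrAC subrr add0r gtr0_norm//.
  apply: (@le_trans _ _ (fp_unit R beta p * b ^ e)).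
    by rewrite /fp_unit -/b -expfzDr// /q le_eqVlt; apply/orP; left; apply/eqP;
      congr (_ ^ _); lia.
  by rewrite ler_wpM2l// exprz_ge0// ltW.
- move=> z [s [k [f [/andP[k1 k2] ->]]]]; case: s; last first.
    rewrite expr0 mul1r -/b.
    (* With exponent at least [e + 1] a float is an integer multiple of [q]; with a smaller one it
       is at most [b ^ e], hence at most the lower neighbour. *)
    have [fe|fe] := leP (e + 1) f.
      have -> : k%:R * b ^ (f - p%:Z) =
          (k * beta ^ absz (f - (e + 1))%R)%N%:R * q.
        rewrite natrM natrX -mulrA -/b; congr (_ * _).
        rewrite exprnP -expfzDr//; congr (_ ^ _); lia.
      by rewrite !ler_pM2r// !ler_nat; case: leqP.
    apply/orP; left; apply: (@le_trans _ _ (b ^ e)).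
      apply: (@le_trans _ _ (b ^+ p * b ^ (f - p%:Z))).
        by rewrite ler_pM2r ?exprz_gt0// -natrX ler_nat ltnW.
      by rewrite exprnP -expfzDr// ler_weXz2l ?(ltW b1)//; lia.
    by rewrite -qp1 mulrC ler_pM2r// -natrX ler_nat.
  apply/orP; left; apply: (@le_trans _ _ 0).
    by rewrite expr1 !mulNr oppr_le0 mul1r mulr_ge0// exprz_ge0// ltW.
  by rewrite mulr_ge0// ltW.
Qed.

(** The two neighbours are the extrema selected by [xget], so its default value 0 does not
    interfere. *)
Lemma fp_floor_ceil (R : realType) (beta p : nat) (y : R) :
  (2 <= beta)%N -> (1 <= p)%N -> y != 0 -> ~ fp beta p y ->
  fp_floor beta p y < y < fp_ceil beta p y /\
  fp_ceil beta p y - fp_floor beta p y <= fp_unit R beta p * `|y|.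
Proof.
move=> hb hp y0 fy.
have [lo [hi [f1 f2 /andP[l1 l2] l3 l4]]] := fp_neighbours hb hp y0 fy.
have -> : fp_floor beta p y = lo.
  apply: xget_unique.
    split; first by split=> //; exact: ltW.
    by move=> z [/l4/orP[//|hz]]; move=> /(le_trans hz); rewrite leNgt l2.
  move=> z [[fz zy] uz]; apply/le_anti.
  rewrite uz ?andbT; last by split=> //; exact: ltW.
  by have /orP[//|hz] := l4 _ fz; move: (le_trans hz zy); rewrite leNgt l2.
have -> : fp_ceil beta p y = hi.
  apply: xget_unique.
    split; first by split=> //; exact: ltW.
    move=> z [/l4/orP[hz|//]] => h; have := le_trans h hz.
    by rewrite leNgt l1.
  move=> z [[fz zy] uz]; apply/le_anti.
  rewrite uz ?andTb; last by split=> //; exact: ltW.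
  by have /orP[hz|//] := l4 _ fz; move: (le_trans zy hz); rewrite leNgt l1.
by rewrite l1 l2.
Qed.

(** Casts one rounding in the form required by Hoeffding's lemma. The list has one point when the
    result is exact and two otherwise, which lets later proofs ignore the distinction. *)
Lemma sr_prob_support (R : realType) (beta p : nat) (y : R) :
  (2 <= beta)%N -> (1 <= p)%N ->
  exists s : seq R, [/\ uniq s, forall z, 0 <= sr_prob beta p y z,
    \sum_(z <- s) sr_prob beta p y z = 1,
    \sum_(z <- s) sr_prob beta p y z * (z - y) = 0 &
    {in s, forall z, `|z - y| <= fp_unit R beta p * `|y|}].
Proof.
move=> hb hp; have u0 : 0 <= fp_unit R beta p by rewrite exprz_ge0.
rewrite /sr_prob; case: asboolP => [_|/not_orP[fy /eqP y0]].
  exists [:: y]; split=> //.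
  - by rewrite big_seq1 eqxx.
  - by rewrite big_seq1 subrr mulr0.
  - by move=> z; rewrite inE => /eqP->; rewrite subrr normr0 mulr_ge0.
have [/andP[h1 h2] h3] := fp_floor_ceil hb hp y0 fy.
rewrite /fp_theta.
set lo := fp_floor _ _ _ in h1 h3 *; set hi := fp_ceil _ _ _ in h2 h3 *.
have lohi : lo < hi by apply: lt_trans h2.
have lohi' : (lo == hi) = false by rewrite lt_eqF.
have d0 : 0 < hi - lo by rewrite subr_gt0.
have dn0 : hi - lo != 0 by rewrite gt_eqF.
exists [:: hi; lo]; split.
- by rewrite /= inE eq_sym lohi'.
- move=> z; case: ifP => _; first by rewrite divr_ge0//; lra.
  by case: ifP => // _; rewrite subr_ge0 ler_pdivrMr// mul1r; lra.
- by rewrite !big_cons big_nil !eqxx lohi'; field.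
- by rewrite !big_cons big_nil !eqxx lohi'; field.
- move=> z; rewrite !inE => /orP[] /eqP->.
    by apply: le_trans h3; rewrite ger0_norm; lra.
  by apply: le_trans h3; rewrite ler0_norm; lra.
Qed.

(** * Chernoff bound by backward induction on histories *)

Lemma fine_measure_support d (T : measurableType d) (R : realType)
    (P : probability T R) (c : {RV P >-> R}) (s : seq R) (H E : set T) :
  uniq s -> measurable H -> measurable E ->
  \sum_(y <- s) fine (P (H `&` [set t | c t = y])) = fine (P H) ->
  fine (P (H `&` E)) = \sum_(y <- s) fine (P (H `&` [set t | c t = y] `&` E)).
Proof.
move=> us mH mE sH.
have mc y : measurable [set t | c t = y].
  exact: (measurable_funPTI c (measurable_set1 y)).
have split_ (G : set T) : measurable G ->
    fine (P (G `&` \bigcup_(y in [set` s]) [set t | c t = y])) =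
    \sum_(y <- s) fine (P (G `&` [set t | c t = y])).
  move=> mG; rewrite setI_bigcupr measure_fin_bigcup//=; last 2 first.
  - by move=> y z _ _ [t [[_ <-] [_ <-]]].
  - by move=> y _; exact: measurableI.
  rewrite -fsbig_seq// -EFin_sum_fine//= => y _.
  by apply: fin_num_measure; exact: measurableI.
set U := \bigcup_(y in [set` s]) [set t | c t = y] in split_.
have mU : measurable U by apply: fin_bigcup_measurable => // y _; exact: mc.
have finP (A : set T) : measurable A -> P A \is a fin_num.
  by move=> mA; apply: fin_num_measure.
have D (G : set T) : measurable G ->
    fine (P G) = fine (P (G `&` U)) + fine (P (G `\` U)).
  move=> mG; rewrite -fineD ?finP//; [|exact: measurableI|exact: measurableD].
  by rewrite addeC -measureDI.
have HU0 : fine (P (H `\` U)) = 0.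
  by have := D _ mH; rewrite split_// sH; lra.
have HEU0 : fine (P ((H `&` E) `\` U)) = 0.
  apply/le_anti/andP; split; last exact: fine_ge0.
  rewrite -HU0 fine_le// ?finP//.
  - by apply: measurableD => //; exact: measurableI.
  - exact: measurableD.
  - apply: le_measure; rewrite ?inE//.
    + by apply: measurableD => //; exact: measurableI.
    + exact: measurableD.
    + by move=> t [[Ht _] Ut].
rewrite D; last exact: measurableI.
rewrite HEU0 addr0 split_; last exact: measurableI.
by apply: eq_bigr => y _; rewrite setIAC.
Qed.

(** Convertible with the local [history] of [sr_nearness], whose hypothesis thus applies
    directly. *)
Definition history (T : Type) (R : Type) (c : nat -> T -> R) (k : nat)
    (v : nat -> R) : set T :=
  [set t | forall j, (j < k)%N -> c j t = v j].

Lemma historyS (T R : Type) (c : nat -> T -> R) (k : nat) (v : nat -> R) :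
  history c k.+1 v = history c k v `&` [set t | c k t = v k].
Proof.
apply/seteqP; split => [t h|t [h1 h2] j].
  by split=> [j jk|]; apply: h => //; exact: ltnW.
by rewrite ltnS leq_eqVlt => /orP[/eqP->|/h1].
Qed.

Lemma eq_history (T R : Type) (c : nat -> T -> R) (k : nat) (v w : nat -> R) :
  (forall j, (j < k)%N -> v j = w j) -> history c k v = history c k w.
Proof.
by move=> vw; apply/seteqP; split=> t h j jk; rewrite h// vw.
Qed.

Lemma measurable_history d (T : measurableType d) (R : realType)
    (P : probability T R) (c : nat -> {RV P >-> R}) k v :
  measurable (history (fun j => c j : T -> R) k v).
Proof.
elim: k => [|k IH].
  by rewrite (_ : history _ _ _ = setT)//; apply/seteqP; split.
rewrite historyS; apply: measurableI => //.
exact: (measurable_funPTI (c k) (measurable_set1 (v k))).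
Qed.

(** Averages over the outcomes of one rounding: the term linear in [y - op k v] is centred, so
    Hoeffding's lemma turns it into a quadratic one. Only outcomes within the rounding error need be
    bounded, which lets a deterministic invariant be propagated. *)
Lemma sr_nearness_step d (T : measurableType d) (R : realType)
    (P : probability T R) (beta p N : nat) (op : nat -> (nat -> R) -> R)
    (c : nat -> {RV P >-> R}) (k : nat) (v : nat -> R) (E : set T) (z w : R) :
  (2 <= beta)%N -> (1 <= p)%N -> sr_nearness beta p N op c ->
  (1 <= k <= N)%N -> measurable E ->
  let H := history (fun j => c j : T -> R) k v in
  (0 < P H)%E ->
  (forall y, `|y - op k v| <= fp_unit R beta p * `|op k v| ->
    fine (P (H `&` [set t | c k t = y] `&` E)) <=
    fine (P (H `&` [set t | c k t = y])) * expR (z + w * (y - op k v))) ->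
  fine (P (H `&` E)) <= fine (P H) *
    expR (z + (w * fp_unit R beta p * op k v) ^+ 2 / 2).
Proof.
move=> hb hp hSR kN mE H PH hE.
have [s [us q0 q1 qD sle]] := sr_prob_support (op k v) hb hp.
have mH : measurable H by exact: measurable_history.
have fH : 0 < fine (P H) by rewrite fine_gt0// PH ltey_eq fin_num_measure.
have hq y : fine (P (H `&` [set t | c k t = y])) =
    fine (P H) * sr_prob beta p (op k v) y.
  rewrite -(hSR k v kN PH y) /cond_prob setIC mulrC divfK// gt_eqF//.
rewrite (@fine_measure_support _ _ _ _ (c k) s)//; last first.
  by under eq_bigr do rewrite hq; rewrite -mulr_sumr q1 mulr1.
apply: (@le_trans _ _ (\sum_(y <- s) fine (P H) * expR z *
    (sr_prob beta p (op k v) y * expR (w * (y - op k v))))).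
  rewrite big_seq [leRHS]big_seq; apply: ler_sum => y ys.
  apply: (le_trans (hE y (sle _ ys))).
  by rewrite hq expRD le_eqVlt; apply/orP; left; apply/eqP; ring.
rewrite -mulr_sumr expRD [leRHS]mulrA ler_wpM2l//.
  by rewrite mulr_ge0 ?expR_ge0// ltW.
rewrite -[_ ^+ 2]real_normK ?num_real//; apply: hoeffding_lemma => //.
  under eq_bigr do rewrite mulrCA.
  by rewrite -mulr_sumr qD mulr0.
move=> y /sle; rewrite !normrM -mulrA => h; rewrite ler_wpM2l//.
by rewrite (ger0_norm (exprz_ge0 _ _)).
Qed.

(* [w k * c k + b k] is the martingale, [Inv] a deterministic invariant of the
   computed values that bounds its increments. *)
Lemma sr_nearness_tail d (T : measurableType d) (R : realType)
    (P : probability T R) (beta p N : nat) (op : nat -> (nat -> R) -> R)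
    (c : nat -> {RV P >-> R}) (f : nat -> R -> R) (w b C : nat -> R)
    (Inv : nat -> R -> Prop) :
  (2 <= beta)%N -> (1 <= p)%N -> sr_nearness beta p N op c ->
  (forall k v, op k.+1 v = f k (v k)) ->
  (forall k y, (k < N)%N -> w k.+1 * f k y + b k.+1 = w k * y + b k) ->
  (forall k y y', (k < N)%N -> Inv k y ->
    `|y' - f k y| <= fp_unit R beta p * `|f k y| -> Inv k.+1 y') ->
  (forall k y, (k < N)%N -> Inv k y ->
    `|w k.+1 * fp_unit R beta p * f k y| <= C k) ->
  forall (s e : R) (k : nat) (v : nat -> R), (k <= N)%N -> Inv k (v k) ->
  fine (P (history (fun j => c j : T -> R) k.+1 v `&`
           [set t | e <= s * (w N * c N t + b N)])) <=
  fine (P (history (fun j => c j : T -> R) k.+1 v)) *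
  expR (s * (w k * v k + b k) - e +
                     s ^+ 2 * (\sum_(k <= j < N) C j ^+ 2) / 2).
Proof.
move=> hb hp hSR hop hZ hInv hC s e k v kN.
(* The induction is on the number [m] of operations still to come, for all histories at once. *)
have [m] : exists m, N = (k + m)%N by exists (N - k)%N; rewrite subnKC.
set E := [set t | e <= _].
have mE : measurable E.
  rewrite -[E]setTI; apply: measurable_fun_le => //.
  by apply: measurable_funM => //; apply: measurable_funD => //;
     apply: measurable_funM => //; exact: measurable_funPT.
elim: m k v kN => [|m IH] k v kN Nk inv; set H := history _ _ _.
  have mH : measurable H by exact: measurable_history.
  have NE : N = k by lia.
  (* No operation is left: the history fixes [c N], so the event either contains [H], and the
     exponent is nonnegative, or misses it. *)
  have [ev|ev] := leP e (s * (w k * v k + b k)); last first.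
    rewrite (_ : H `&` E = set0).
      by rewrite measure0 mulr_ge0// ?expR_ge0 ?fine_ge0.
    apply/seteqP; split=> // t [Ht]; rewrite /E/= NE Ht//.
    by rewrite leNgt ev.
  apply: (@le_trans _ _ (fine (P H))).
    rewrite fine_le ?fin_num_measure//; first exact: measurableI.
    by apply: le_measure; rewrite ?inE//; exact: measurableI.
  rewrite ler_peMr ?fine_ge0// -expR0 ler_expR.
  by rewrite NE big_geq// mulr0 mul0r addr0 subr_ge0.
have kN' : (k < N)%N by lia.
have mH : measurable H by exact: measurable_history.
(* [sr_nearness] only concerns histories of positive probability; on a null one both sides
   vanish. *)
have [PH|PH] := leP (P H) 0%E.
  have PH0 : P H = 0%E by apply/le_anti; rewrite PH measure_ge0.
  rewrite PH0 mul0r (_ : P _ = 0%E)//; apply/le_anti.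
  rewrite measure_ge0 andbT -PH0; apply: le_measure; rewrite ?inE//.
  exact: measurableI.
(* The sum starts at [k.+1]: its missing term [C k ^+ 2] will come from Hoeffding's lemma. *)
set z := s * (w k * v k + b k) - e +
   s ^+ 2 * (\sum_(k.+1 <= j < N) C j ^+ 2) / 2.
apply: (@le_trans _ _ (fine (P H) *
    expR (z + (s * w k.+1 * fp_unit R beta p * op k.+1 v) ^+ 2 / 2))).
  apply: (sr_nearness_step hb hp hSR) => // y; rewrite hop => hy.
  pose v' j := if j == k.+1 then y else v j.
  have v'E : v' k.+1 = y by rewrite /v' eqxx.
  have -> : H `&` [set t | c k.+1 t = y] =
      history (fun j => c j : T -> R) k.+2 v'.
    rewrite [RHS]historyS v'E; congr (_ `&` _).
    by apply: eq_history => j jk; rewrite /v' ltn_eqF.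
  have := IH k.+1 v' kN' ltac:(lia).
  rewrite v'E => /(_ (hInv _ _ _ kN' inv hy)) /le_trans; apply.
  rewrite le_eqVlt; apply/orP; left; apply/eqP; congr (_ * expR _).
  by rewrite /z -(hZ k)//; ring.
rewrite ler_wpM2l ?fine_ge0// ler_expR /z [in leRHS]big_ltn//.
have := hC _ _ kN' inv; rewrite hop => h.
have : (w k.+1 * fp_unit R beta p * f k (v k)) ^+ 2 <= C k ^+ 2.
  by rewrite -[_ ^+ 2]real_normK ?num_real// lerXn2r// nnegrE (le_trans _ h).
move=> /(ler_wpM2l (sqr_ge0 s)).
by rewrite -exprMn; lra.
Qed.


(** * Horner's rule as an instance of the tail bound *)

(** Among the first [k] operations [uphalf k] are products, so this is the power of [x] still to
    multiply the current value. *)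
Definition horner_weight (R : realType) (n : nat) (x : R) (k : nat) : R :=
  x ^+ (n - uphalf k).

(** After an odd number [k] of operations the next one is an addition, which consumes the last
    pending monomial. [g] will be the identity or the absolute value. *)
Lemma horner_op_odd (R : realType) (n : nat) (a : nat -> R) (x : R)
    (k : nat) (v : nat -> R) (g : R -> R) : (k < 2 * n)%N -> odd k ->
  [/\ horner_op n a x k.+1 v = v k + a (n - k.+1./2)%N,
    horner_weight n x k.+1 = x ^+ (n - k.+1./2),
    horner_weight n x k = x ^+ (n - k.+1./2) &
    \sum_(i < n - k./2) g (a i * x ^+ i) =
    \sum_(i < n - k.+1./2) g (a i * x ^+ i) +
    g (a (n - k.+1./2)%N * x ^+ (n - k.+1./2))].
Proof.
move=> kn ok; have := odd_double_half k.
rewrite /horner_op /horner_weight /= uphalf_half ok /= add1n => kE.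
split=> //.
by rewrite (_ : (n - k./2)%N = (n - k./2.+1).+1) ?big_ord_recr//; lia.
Qed.

Lemma horner_op_even (R : realType) (n : nat) (a : nat -> R) (x : R)
    (k : nat) (v : nat -> R) : (k < 2 * n)%N -> ~~ odd k ->
  [/\ horner_op n a x k.+1 v = v k * x,
    k.+1./2 = k./2 &
    horner_weight n x k = x * horner_weight n x k.+1].
Proof.
move=> kn ok; have := odd_double_half k.
rewrite /horner_op /horner_weight /= uphalf_half ok (negbTE ok) add0n => kE.
split=> //.
by rewrite -exprS; congr (_ ^+ _); lia.
Qed.

(** The martingale identity: an exact operation only moves a factor [x] or a monomial into the
    current value. *)
Lemma horner_op_exact (R : realType) (n : nat) (a : nat -> R) (x : R)
    (k : nat) (v : nat -> R) : (k < 2 * n)%N ->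
  horner_weight n x k.+1 * horner_op n a x k.+1 v +
    \sum_(i < n - k.+1./2) a i * x ^+ i =
  horner_weight n x k * v k + \sum_(i < n - k./2) a i * x ^+ i.
Proof.
move=> kn; have [ok|ok] := boolP (odd k).
  by have [-> -> -> ->] := horner_op_odd a x v id kn ok; ring.
by have [-> -> ->] := horner_op_even a x v kn ok; ring.
Qed.

(** Same transfer with absolute values, where the addition costs a triangle inequality. *)
Lemma horner_op_norm (R : realType) (n : nat) (a : nat -> R) (x : R)
    (k : nat) (v : nat -> R) : (k < 2 * n)%N ->
  `|horner_weight n x k.+1 * horner_op n a x k.+1 v| +
    \sum_(i < n - k.+1./2) `|a i * x ^+ i| <=
  `|horner_weight n x k * v k| + \sum_(i < n - k./2) `|a i * x ^+ i|.
Proof.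
move=> kn; have [ok|ok] := boolP (odd k).
  have [-> -> -> ->] := horner_op_odd a x v Num.norm kn ok.
  by rewrite mulrDr [a _ * _]mulrC addrA addrAC lerD2r ler_normD.
have [-> -> ->] := horner_op_even a x v kn ok.
by rewrite (mulrC (v k)) mulrCA mulrA.
Qed.

(** The geometric sum equals u gamma / (2 + u), with gamma = [gamma_err (2 * N) u]; the induction
    loses u^3 (1 + u)^(2 m) at step m. *)
Lemma sum_growth_sqr (R : realType) (u : R) (N : nat) : 0 <= u ->
  2 * \sum_(0 <= j < N) (u * (1 + u) ^+ j) ^+ 2 <= u * gamma_err (2 * N) u.
Proof.
move=> u0; rewrite /gamma_err; elim: N => [|m IH].
  by rewrite big_geq// mulr0 muln0 expr0 subrr mulr0.
rewrite big_nat_recr//= mulrDr mulnS exprD exprMn -exprM (mulnC m).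
have q0 : 0 <= (1 + u) ^+ (2 * m) by rewrite exprn_ge0// addr_ge0.
move: IH q0; set q := (1 + u) ^+ (2 * m).
set s := \sum_(_ <= _ < _) _ => IH q0.
have : 0 <= u * (u ^+ 2 * q) by rewrite !mulr_ge0.
lra.
Qed.

(** The sign of [s] is free, so that both tails follow from this one bound. *)
Lemma horner_tail d (T : measurableType d) (R : realType)
    (P : probability T R) (beta p n : nat) (a : nat -> R) (x : R)
    (r : nat -> {RV P >-> R}) :
  (2 <= beta)%N -> (1 <= p)%N -> (forall t, r 0%N t = a n) ->
  sr_nearness beta p (2 * n) (horner_op n a x) r ->
  let u := fp_unit R beta p in
  let S := \sum_(i < n.+1) `|a i * x ^+ i| in
  forall s e : R,
  fine (P [set t | e <= s * r (2 * n)%N t]) <=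
  expR (s * (\sum_(i < n.+1) a i * x ^+ i) - e +
        s ^+ 2 * (S ^+ 2 * (u * gamma_err (4 * n) u) / 2) / 2).
Proof.
move=> hb hp hr0 hSR u S s e.
have u0 : 0 < u by rewrite exprz_gt0// ltr0n; lia.
have S0 : 0 <= S by apply: sumr_ge0.
pose f k y := horner_op n a x k.+1 (fun=> y).
(* Each rounding inflates the current value, and so this total, by at most [1 + u]. *)
pose Inv k y := `|horner_weight n x k * y| +
  \sum_(i < n - k./2) `|a i * x ^+ i| <= (1 + u) ^+ k * S.
(* The increment is that of operation [k.+1], so only [k] roundings precede it. *)
pose C k := S * (u * (1 + u) ^+ k).
have norm_le k y : (k < 2 * n)%N -> Inv k y ->
    `|horner_weight n x k.+1 * f k y| +
    \sum_(i < n - k.+1./2) `|a i * x ^+ i| <= (1 + u) ^+ k * S.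
  by move=> kn; apply: le_trans; exact: horner_op_norm.
have hop k v : horner_op n a x k.+1 v = f k (v k) by [].
have hZ k y : (k < 2 * n)%N -> horner_weight n x k.+1 * f k y +
    \sum_(i < n - k.+1./2) a i * x ^+ i =
    horner_weight n x k * y + \sum_(i < n - k./2) a i * x ^+ i.
  by move=> kn; rewrite horner_op_exact.
have hInv k y y' : (k < 2 * n)%N -> Inv k y ->
    `|y' - f k y| <= u * `|f k y| -> Inv k.+1 y'.
  move=> kn /(norm_le _ _ kn) inv yy'.
  set B := \sum_(i < _) _ in inv; rewrite /Inv -/B.
  have B0 : 0 <= B by apply: sumr_ge0.
  have : `|y'| <= (1 + u) * `|f k y|.
    rewrite -[y'](subrK (f k y)) (le_trans (ler_normD _ _))//; lra.
  move=> /(ler_wpM2l (normr_ge0 (horner_weight n x k.+1))).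
  rewrite -normrM mulrCA -normrM => h; rewrite exprS -mulrA.
  have u1 : 0 <= 1 + u by lra.
  have := ler_wpM2l u1 inv.
  (* The pending monomials [B] are not rounded; inflating them too only weakens the bound. *)
  have : 0 <= u * B by rewrite mulr_ge0// ltW.
  lra.
have hC k y : (k < 2 * n)%N -> Inv k y ->
    `|horner_weight n x k.+1 * u * f k y| <= C k.
  move=> kn /(norm_le _ _ kn) inv.
  rewrite mulrAC [X in `|X|]mulrC normrM (gtr0_norm u0) /C [leRHS]mulrC -mulrA.
  rewrite ler_wpM2l ?(ltW u0)//; apply: le_trans inv.
  by rewrite lerDl sumr_ge0.
pose v (j : nat) := a n.
have PxE (g : R -> R) : \sum_(i < n.+1) g (a i * x ^+ i) =
    g (a n * x ^+ n) + \sum_(i < n - 0./2) g (a i * x ^+ i).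
  by rewrite big_ord_recr/= subn0 addrC.
have inv0 : Inv 0%N (v 0%N).
  by rewrite /Inv expr0 mul1r /S (PxE Num.norm) /horner_weight subn0 mulrC.
have := sr_nearness_tail hb hp hSR hop hZ hInv hC s e (leq0n _) inv0.
(* The history of length 1 only records [r 0], which is [a n] everywhere. *)
rewrite (_ : history _ _ _ = setT); last first.
  by apply/seteqP; split=> // t _ j; rewrite ltnS leqn0 => /eqP->; exact: hr0.
have PE : horner_weight n x 0 * v 0%N + \sum_(i < n - 0./2) a i * x ^+ i =
    \sum_(i < n.+1) a i * x ^+ i.
  by rewrite (PxE id) /horner_weight subn0 mulrC.
have wN : horner_weight n x (2 * n) = 1.
  by rewrite /horner_weight mul2n uphalf_double subnn.
have n2 : (n - (2 * n)./2)%N = 0%N by rewrite mul2n doubleK subnn.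
rewrite setTI probability_setT mul1r PE wN n2 big_ord0.
under [in X in X -> _]eq_set => t do rewrite mul1r addr0.
move=> /le_trans; apply.
rewrite ler_expR lerD2l ler_wpM2r// ler_wpM2l ?sqr_ge0//.
under eq_bigr do rewrite exprMn.
rewrite -mulr_sumr -mulrA ler_wpM2l ?sqr_ge0// ler_pdivlMr// mulrC.
have -> : (4 * n = 2 * (2 * n))%N by rewrite mulnA.
exact: sum_growth_sqr (ltW u0).
Qed.

(** * Choice of the Chernoff parameter and union of the two tails *)

Theorem theorem4p5 (R : realType) (beta p : nat)
    (hbeta : (2 <= beta)%N) (hp : (1 <= p)%N)
    (d : measure_display) (T : measurableType d) (P : probability T R)
    (n : nat) (hn : (1 <= n)%N) (a : nat -> R) (x : R)
    (hPx : \sum_(i < n.+1) a i * x ^+ i != 0)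
    (r delta : nat -> {RV P >-> R})
    (hr0 : forall t : T, r 0%N t = a n)
    (hmul : forall (k : nat) (t : T), (1 <= k <= n)%N ->
       r (2 * k - 1)%N t
         = r (2 * k - 2)%N t * x * (1 + delta (2 * k - 1)%N t))
    (hadd : forall (k : nat) (t : T), (1 <= k <= n)%N ->
       r (2 * k)%N t
         = (r (2 * k - 1)%N t + a (n - k)%N) * (1 + delta (2 * k)%N t))
    (hdelta0 : forall (k : nat) (t : T), (1 <= k <= 2 * n)%N ->
       horner_op n a x k (fun j => r j t) = 0 -> delta k t = 0)
    (hSR : sr_nearness beta p (2 * n) (horner_op n a x) r)
    (lambda : R) (hlambda : 0 < lambda < 1) :
  let u : R := fp_unit R beta p in
  let Px : R := \sum_(i < n.+1) a i * x ^+ i in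
  let K1 : R := (\sum_(i < n.+1) `|a i * x ^+ i|) / `|Px| in
  ((1 - lambda)%:E <=
   P [set t | (`|r (2 * n)%N t - Px| / `|Px| <=
        K1 * Num.sqrt (u * gamma_err (4 * n) u)
           * Num.sqrt (ln (2 / lambda)))%R])%E.
Proof.
cbv zeta; set u := fp_unit R beta p; set Px := \sum_(i < n.+1) a i * x ^+ i.
set K1 := _ / `|Px|.
have /andP[l0 l1] := hlambda.
have tail := horner_tail hbeta hp hr0 hSR; rewrite -/Px -/u /= in tail.
have nPx : 0 < `|Px| by rewrite normr_gt0.
have u0 : 0 < u by rewrite exprz_gt0// ltr0n; lia.
have g0 : 0 < gamma_err (4 * n) u.
  by rewrite subr_gt0 exprn_egt1 ?ltrDl// muln_eq0; lia.
set S := \sum_(i < n.+1) `|a i * x ^+ i| in K1 tail *.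
have S0 : 0 < S by apply: (lt_le_trans nPx); exact: ler_norm_sum.
set L := ln (2 / lambda).
have L0 : 0 < L by rewrite ln_gt0// ltr_pdivlMr//; lra.
pose eps := S * Num.sqrt (u * gamma_err (4 * n) u) * Num.sqrt L.
pose V := S ^+ 2 * (u * gamma_err (4 * n) u) / 2.
have V0 : 0 < V by rewrite divr_gt0// mulr_gt0 ?exprn_gt0// mulr_gt0.
have eps0 : 0 <= eps by rewrite !mulr_ge0 ?sqrtr_ge0 ?ltW.
have epsV : eps ^+ 2 = 2 * V * L.
  rewrite /eps !exprMn !sqr_sqrtr ?(ltW L0) ?mulr_ge0 ?(ltW u0) ?(ltW g0)//.
  by rewrite /V; field.
(* The optimal parameters are [eps / V] and its opposite, which minimise - |s| eps + s^2 V / 2; then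
   |s| eps is [eps ^+ 2 / V]. *)
pose B (s : R) := [set t | s * Px + eps ^+ 2 / V <= s * r (2 * n)%N t].
have mB s : measurable (B s).
  rewrite -[B s]setTI; apply: measurable_fun_le => //.
  by apply: measurable_funM => //; exact: measurable_funPT.
have PB s : s ^+ 2 = (eps / V) ^+ 2 -> (P (B s) <= (lambda / 2)%:E)%E.
  move=> sE; rewrite -[P _]fineK ?fin_num_measure// lee_fin.
  apply: (le_trans (tail _ _)); rewrite -/V sE.
  (* The exponent is - eps^2 / (2 V), and [epsV] makes it [- L], whose exponential is
     [lambda / 2]. *)
  rewrite (_ : _ + _ = - L).
    by rewrite expRN lnK ?posrE ?divr_gt0// invf_div.
  rewrite expr_div_n epsV; field.
  by rewrite gt_eqF.
set G := [set t | _].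
have mG : measurable G.
  rewrite -[G]setTI; apply: measurable_fun_le => //.
  apply: measurable_funM => //; apply: measurableT_comp => //.
  by apply: measurable_funB => //; exact: measurable_funPT.
(* A failure is a deviation of more than [eps] on one side; multiplying by [eps / V] puts it in one
   of the two tails. *)
have GB : ~` G `<=` B (eps / V) `|` B (- (eps / V)).
  move=> t /negP; rewrite -ltNge ltr_pdivlMr//.
  rewrite (_ : _ * `|Px| = eps); last first.
    by rewrite /K1 /eps; field; rewrite gt_eqF.
  have eV : 0 <= eps / V by rewrite divr_ge0// ltW.
  rewrite /B /= expr2 lter_normr => /orP[]/ltW/(ler_wpM2l eV) h; [left|right];
    by move: h; rewrite mulrAC; lra.
rewrite -[G]setCK probability_setC; last exact: measurableC.
rewrite EFinB leeB//.
apply: (@le_trans _ _ (P (B (eps / V) `|` B (- (eps / V))))).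
  apply: le_measure; rewrite ?inE//; first exact: measurableC.
  exact: measurableU.
apply: (le_trans (measureU2 _ (mB _) (mB _))).
by rewrite [lambda]splitr EFinD leeD ?PB ?sqrrN.
Qed.
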